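(* For a $T_1$-space $X$ the following are equivalent: (1) $X$ has a point-countable base, and $X$ has a base which is point-regular at non-isolated points; (2) $X$ has a point-countable base which is point-regular at non-isolated points; (3) $X$ is an open, boundary-compact $s$-image of a metric space; (4) $X$ is an open $s$-image of a metric space and also an open boundary-compact image of a metric space; (5) $X$ is a metalindelöf space with a base which is point-regular at non-isolated points.
   Context: $I(X)$ is the set of isolated points. A base $\mathcal{B}$ of $X$ is point-regular at non-isolated points if for every $x\in X\setminus I(X)$ and open $U\ni x$, the set $\{B\in\mathcal{B}: x\in B\not\subset U\}$ is finite. A family is point-countable if each point lies in at most countably many members. $X$ is metalindelöf if every open cover has a point-countable open refinement. Maps are continuous and onto. A map $f:M\to X$ is open if it maps open sets to open sets; it is boundary-compact if for each $x\in X$ the boundary $\partial f^{-1}(x)$ is compact; it is an $s$-map if each fiber $f^{-1}(x)$ is separable. *)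

(* Defs.v *)
From Stdlib Require Import Reals List.
Open Scope R_scope.

Definition set (X : Type) := X -> Prop.

Record is_topology {X : Type} (op : set X -> Prop) : Prop := {
  top_full  : op (fun _ => True);
  top_inter : forall U V, op U -> op V -> op (fun x => U x /\ V x);
  top_union : forall F : set (set X), (forall U, F U -> op U) ->
                op (fun x => exists U, F U /\ U x)
}.

Definition subset {X : Type} (A B : set X) : Prop := forall x, A x -> B x.

Definition countable {T : Type} (A : set T) : Prop :=
  exists g : nat -> T, forall a, A a -> exists n, g n = a.

Definition finite_set {T : Type} (A : set T) : Prop :=
  exists l : list T, forall a, A a -> In a l.

Section Topology.
Context {X : Type} (op : set X -> Prop).

Definition T1_space : Prop :=
  forall x y : X, x <> y -> exists U, op U /\ U x /\ ~ U y.

Definition isolated (x : X) : Prop := op (fun y => y = x).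

Definition is_base (B : set (set X)) : Prop :=
  (forall b, B b -> op b) /\
  (forall U x, op U -> U x -> exists b, B b /\ b x /\ subset b U).

Definition point_countable (F : set (set X)) : Prop :=
  forall x, countable (fun b => F b /\ b x).

Definition point_regular_nonisolated (B : set (set X)) : Prop :=
  forall x, ~ isolated x -> forall U, op U -> U x ->
    finite_set (fun b => B b /\ b x /\ ~ subset b U).

Definition open_cover (C : set (set X)) : Prop :=
  (forall U, C U -> op U) /\ (forall x, exists U, C U /\ U x).

Definition refines (R C : set (set X)) : Prop :=
  forall V, R V -> exists U, C U /\ subset V U.

Definition metalindelof : Prop :=
  forall C, open_cover C ->
    exists R, open_cover R /\ refines R C /\ point_countable R.

Definition closure (A : set X) : set X :=
  fun x => forall U, op U -> U x -> exists y, U y /\ A y.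

Definition interior (A : set X) : set X :=
  fun x => exists U, op U /\ U x /\ subset U A.

Definition boundary (A : set X) : set X :=
  fun x => closure A x /\ ~ interior A x.

Definition compact_subset (K : set X) : Prop :=
  forall C : set (set X), (forall U, C U -> op U) ->
    (forall x, K x -> exists U, C U /\ U x) ->
    exists l : list (set X), (forall U, In U l -> C U) /\
      (forall x, K x -> exists U, In U l /\ U x).

Definition separable_subset (A : set X) : Prop :=
  exists D : set X, subset D A /\ countable D /\
    forall x U, A x -> op U -> U x -> exists y, D y /\ U y.

End Topology.

Definition is_metric {M : Type} (d : M -> M -> R) : Prop :=
  (forall x y, 0 <= d x y) /\
  (forall x y, d x y = 0 <-> x = y) /\
  (forall x y, d x y = d y x) /\
  (forall x y z, d x z <= d x y + d y z).

Definition metric_open {M : Type} (d : M -> M -> R) (U : set M) : Prop :=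
  forall x, U x -> exists eps, 0 < eps /\ forall y, d x y < eps -> U y.

Section Maps.
Context {M X : Type} (opM : set M -> Prop) (opX : set X -> Prop) (f : M -> X).

Definition continuous_map : Prop :=
  forall V, opX V -> opM (fun m => V (f m)).

Definition surjective_map : Prop := forall x, exists m, f m = x.

Definition open_map : Prop :=
  forall U, opM U -> opX (fun x => exists m, U m /\ f m = x).

Definition fiber (x : X) : set M := fun m => f m = x.

Definition boundary_compact_map : Prop :=
  forall x, compact_subset opM (boundary opM (fiber x)).

Definition s_map : Prop :=
  forall x, separable_subset opM (fiber x).

End Maps.

Definition metric_image {X : Type} (opX : set X -> Prop)
  (P : forall M : Type, (set M -> Prop) -> (M -> X) -> Prop) : Prop :=
  exists (M : Type) (d : M -> M -> R) (f : M -> X),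
    is_metric d /\
    continuous_map (metric_open d) opX f /\
    surjective_map f /\
    P M (metric_open d) f.

(* Main.v *)
(** A base that is point-regular at the non-isolated points has maximal members
    through every such point, and stripping off these maximal members again and
    again yields levels that are point-finite at the non-isolated points and whose
    stars shrink there: a "development at the non-isolated points". Adding the
    isolated singletons turns such a development back into a base of the same kind.
    If X is metalindelof, the levels can be shrunk to point-countable ones; then the
    sequences (g_n) of members of the levels that form a local base at a point
    make up a subspace of a Baire space, and the map to that point is open.
    Over a non-isolated point its fiber is compact by Koenig's argument, over an
    isolated one the fiber is clopen. Conversely, given an open map f from a metric
    space, take the images of locally finite covers of mesh 2^-n: a separable fiber
    meets countably many members of them, and a fiber over a non-isolated point,
    having empty interior, equals its boundary, so that it meets finitely many
    members of each cover when it is boundary-compact. *)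

Require Import Defs.
From Stdlib Require Import Reals List.
From Stdlib Require Import Lra Lia Classical ClassicalEpsilon.
From Stdlib Require Import FunctionalExtensionality PropExtensionality Cantor.
From mathcomp.classical Require boolp wochoice.
Set Bullet Behavior "Strict Subproofs".

(** * Extensionality, choice and well-orders *)

Lemma set_ext {T : Type} (A B : set T) : (forall x, A x <-> B x) -> A = B.
Proof.
  intros H; apply functional_extensionality; intros x.
  apply propositional_extensionality, H.
Qed.

Lemma choice_fun {A B : Type} (R : A -> B -> Prop) :
  (forall a, exists b, R a b) -> exists f : A -> B, forall a, R a (f a).
Proof.
  intros H.
  exists (fun a => proj1_sig (constructive_indefinite_description _ (H a))).
  intros a; apply proj2_sig.
Qed.

(** The imported principle gives unique minima for a boolean relation; uniqueness on a two-point set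
    yields antisymmetry. The order will index the balls of a metric space. *)
Lemma well_order_exists (T : Type) :
  exists R : T -> T -> Prop,
    (forall A : set T, (exists x, A x) ->
       exists z, A z /\ forall x, A x -> R z x) /\
    (forall x y, R x y -> R y x -> x = y).
Proof.
  destruct (wochoice.well_ordering_principle
    (boolp.boolp_classicType__canonical__eqtype_Equality T)) as [r Hr].
  exists (fun x y => r x y = true).
  assert (Hmin : forall A : set T, (exists x, A x) ->
    exists z, (A z /\ forall x, A x -> r z x = true) /\
      forall z', (A z' /\ forall x, A x -> r z' x = true) -> z = z').
  { intros A [x0 Hx0].
    destruct (Hr (fun x : T => boolp.asbool (A x))) as [z [[Hz1 Hz2] Hz3]].
    - exists x0. now apply boolp.asboolT.
    - exists z. split.
      + split. { now apply boolp.asboolW. }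
        intros x Hx; apply Hz2. now apply boolp.asboolT.
      + intros z' [H1 H2]. apply Hz3. split.
        * now apply boolp.asboolT.
        * intros x Hx; apply H2. now apply boolp.asboolW. }
  split.
  - intros A HA. destruct (Hmin A HA) as [z [Hz _]]. now exists z.
  - assert (Hrefl : forall x, r x x = true).
    { intros x. destruct (Hmin (fun y => y = x)) as [z [[Hz Hz'] _]].
      - now exists x.
      - subst z. now apply Hz'. }
    intros x y Hxy Hyx.
    destruct (Hmin (fun z => z = x \/ z = y)) as [z [_ Hu]]. { exists x; now left. }
    transitivity z.
    + symmetry. apply Hu. split; [now left|]. intros w [->| ->]; auto.
    + apply Hu. split; [now right|]. intros w [->| ->]; auto.
Qed.

(** * Finite and countable families *)

Lemma finite_subset {T : Type} (A B : set T) :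
  subset A B -> finite_set B -> finite_set A.
Proof. intros H [l Hl]; exists l; intros a Ha; apply Hl, H, Ha. Qed.

Lemma finite_at_most_one {T : Type} (A : set T) :
  (forall a b, A a -> A b -> a = b) -> finite_set A.
Proof.
  intros H. destruct (classic (exists a, A a)) as [[a Ha]|Hn].
  - exists (a :: nil). intros b Hb. left; auto.
  - exists nil. intros b Hb. apply Hn; now exists b.
Qed.

Lemma finite_list_union {I T : Type} (l : list I) (F : I -> set T) :
  (forall i, In i l -> finite_set (F i)) ->
  finite_set (fun x => exists i, In i l /\ F i x).
Proof.
  induction l as [|i l IH]; intros H.
  - exists nil. intros a [i [[] _]].
  - destruct (H i) as [l1 H1]; [now left|].
    destruct IH as [l2 H2]; [intros j Hj; apply H; now right|].
    exists (l1 ++ l2). intros a [j [[<-|Hj] Ha]]; apply in_or_app; [left|right]; auto.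
    apply H2. now exists j.
Qed.

Lemma finite_lt_union {T : Type} (n : nat) (F : nat -> set T) :
  (forall i, (i < n)%nat -> finite_set (F i)) ->
  finite_set (fun x => exists i, (i < n)%nat /\ F i x).
Proof.
  intros H. apply (finite_subset _ (fun x => exists i, In i (seq 0 n) /\ F i x)).
  - intros x [i [Hi Hx]]. exists i. split; auto. apply in_seq; lia.
  - apply finite_list_union. intros i Hi. apply H. apply in_seq in Hi; lia.
Qed.

Lemma finite_image {S T : Type} (f : S -> T) (A : set S) :
  finite_set A -> finite_set (fun y => exists x, A x /\ f x = y).
Proof.
  intros [l Hl]. exists (map f l). intros y [x [Hx <-]]. apply in_map; auto.
Qed.

Lemma countable_subset {T : Type} (A B : set T) :
  subset A B -> countable B -> countable A.
Proof. intros H [g Hg]; exists g; intros a Ha; apply Hg, H, Ha. Qed.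

Lemma finite_countable {T : Type} (t0 : T) (A : set T) : finite_set A -> countable A.
Proof.
  intros [l Hl]. exists (fun n => nth n l t0). intros a Ha.
  destruct (In_nth l a t0 (Hl a Ha)) as [n [_ Hn]]. now exists n.
Qed.

Lemma countable_image {S T : Type} (f : S -> T) (A : set S) :
  countable A -> countable (fun y => exists x, A x /\ f x = y).
Proof.
  intros [g Hg]. exists (fun n => f (g n)). intros y [x [Hx <-]].
  destruct (Hg x Hx) as [n <-]. now exists n.
Qed.

Lemma countable_nat_union {T : Type} (F : nat -> set T) :
  (forall n, countable (F n)) -> countable (fun x => exists n, F n x).
Proof.
  intros H. destruct (choice_fun _ H) as [g Hg].
  exists (fun k => g (fst (of_nat k)) (snd (of_nat k))).
  intros x [n Hx]. destruct (Hg n x Hx) as [m Hm].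
  exists (to_nat (n, m)). now rewrite cancel_of_to.
Qed.

(* Codes every finite prefix of a sequence of naturals by a single number. *)
Fixpoint decode (k i : nat) : nat :=
  match i with
  | O => fst (of_nat k)
  | S i => decode (snd (of_nat k)) i
  end.

Lemma decode_prefix (n : nat) : forall c : nat -> nat,
  exists k, forall i, (i < n)%nat -> decode k i = c i.
Proof.
  induction n as [|n IH]; intros c.
  - exists O. intros; lia.
  - destruct (IH (fun i => c (S i))) as [k Hk].
    exists (to_nat (c O, k)). intros [|i] Hi; cbn [decode]; rewrite cancel_of_to; cbn.
    + reflexivity.
    + apply Hk; lia.
Qed.

Lemma half_pow_pos (n : nat) : 0 < (/2)^n.
Proof. apply pow_lt; lra. Qed.

Lemma half_pow_antitone (n m : nat) : (n <= m)%nat -> (/2)^m <= (/2)^n.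
Proof.
  induction 1 as [|m H IH]; [lra|].
  simpl. pose proof (half_pow_pos m). lra.
Qed.

Lemma half_pow_small (e : R) : 0 < e -> exists n, (/2)^n < e.
Proof.
  intros He. destruct (pow_lt_1_zero (/2)) with (y := e) as [n Hn]; auto.
  - rewrite Rabs_pos_eq; lra.
  - exists n. specialize (Hn n (Nat.le_refl _)).
    rewrite Rabs_pos_eq in Hn; auto. pose proof (half_pow_pos n); lra.
Qed.

(** * Locally finite covers of metric spaces *)

Section Metric.
Context {M : Type} (d : M -> M -> R) (Hd : is_metric d).

Lemma metric_refl x : d x x = 0.
Proof. now apply Hd. Qed.

Lemma metric_sym x y : d x y = d y x.
Proof. apply Hd. Qed.

Lemma metric_triangle x y z : d x z <= d x y + d y z.
Proof. apply Hd. Qed.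

Lemma metric_ball_open a r : metric_open d (fun y => d a y < r).
Proof.
  intros x Hx. exists (r - d a x). split; [lra|].
  intros y Hy. pose proof (metric_triangle a x y); lra.
Qed.

Section Stone.
Context (R : M -> M -> Prop)
  (Rleast : forall A : set M, (exists x, A x) ->
     exists z, A z /\ forall x, A x -> R z x)
  (Ranti : forall x y, R x y -> R y x -> x = y)
  (eps : Rdefinitions.R) (Heps : 0 < eps).

(** The cover to be refined, indexed by its own centers; the radius is halved so that two points of
    one ball are less than [eps] apart. *)
Let C (a x : M) : Prop := d a x < eps / 2.

Definition first_center (a x : M) : Prop :=
  C a x /\ forall b, C b x -> R a b.

(* M. E. Rudin's construction. For fixed [n], distinct pieces are at distance at
   least 2^-n: their centers are 3 * 2^-n apart by minimality of the indices. *)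
Definition stone_piece (S : set M) (a : M) (n : nat) : set M := fun p =>
  exists x, first_center a x /\ ~ S x /\
    (forall y, d x y < 3 * (/2)^n -> C a y) /\ d x p < (/2)^n.

Fixpoint stone_union (n : nat) : set M :=
  match n with
  | O => fun _ => False
  | S n => fun p => stone_union n p \/ exists a, stone_piece (stone_union n) a n p
  end.

Let D (a : M) (n : nat) : set M := stone_piece (stone_union n) a n.

Lemma stone_union_mono n m : (n <= m)%nat -> subset (stone_union n) (stone_union m).
Proof.
  induction 1 as [|m H IH]; intros x Hx; auto. left; auto.
Qed.

Lemma stone_union_inv n x : stone_union n x -> exists j a, D a j x.
Proof.
  induction n as [|n IH]; intros H; [destruct H|].
  destruct H as [H|[a H]]; auto. now exists n, a.
Qed.

Lemma stone_piece_open a n : metric_open d (D a n).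
Proof.
  intros p [x [H1 [H2 [H3 H4]]]].
  exists ((/2)^n - d x p). split; [lra|]. intros y Hy.
  exists x. repeat split; try apply H1; auto.
  pose proof (metric_triangle x p y). lra.
Qed.

(** Take the least [a] whose ball holds [x], and [n] so large that the ball of radius 3 * 2^-n about
    [x] stays inside it. Either an earlier level covers [x], or [x] is itself a center at level
    [n]. *)
Lemma stone_piece_cover x : exists n a, D a n x.
Proof.
  destruct (Rleast (fun a => C a x)) as [a [Ha Hmin]].
  { exists x. unfold C. rewrite metric_refl. lra. }
  destruct (half_pow_small ((eps / 2 - d a x) / 3)) as [n Hn].
  { unfold C in Ha. lra. }
  destruct (classic (stone_union n x)) as [H|H].
  - now apply stone_union_inv in H.
  - exists n, a, x. repeat split; auto.
    + intros y Hy. unfold C. pose proof (metric_triangle a x y). lra.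
    + rewrite metric_refl. apply half_pow_pos.
Qed.

Lemma stone_piece_mesh a n p q : D a n p -> D a n q -> d p q < eps.
Proof.
  intros [x [_ [_ [H1 H2]]]] [y [_ [_ [H3 H4]]]].
  pose proof (half_pow_pos n).
  assert (Hp : C a p) by (apply H1; lra).
  assert (Hq : C a q) by (apply H3; lra).
  unfold C in Hp, Hq. pose proof (metric_triangle p a q).
  rewrite (metric_sym p a) in *. lra.
Qed.

Lemma stone_pieces_separated a b n p q :
  a <> b -> D a n p -> D b n q -> (/2)^n <= d p q.
Proof.
  intros Hab [x [[Hx1 Hx2] [_ [Hx3 Hx4]]]] [y [[Hy1 Hy2] [_ [Hy3 Hy4]]]].
  destruct (Rle_or_lt ((/2)^n) (d p q)) as [|Hlt]; auto. exfalso.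
  assert (Hxy : d x y < 3 * (/2)^n).
  { pose proof (metric_triangle x p y). pose proof (metric_triangle p q y).
    rewrite (metric_sym q y) in *. lra. }
  (* Each center lies in the ball of the other, so minimality bounds each index by the other. *)
  apply Hab, Ranti.
  - apply Hx2, Hy3. now rewrite metric_sym.
  - apply Hy2, Hx3, Hxy.
Qed.

(** Some piece contains a ball about [x]. Centers of later levels avoid this ball, so pieces of high
    level stay away from [x]; at each lower level, separation leaves at most one piece near [x]. *)
Lemma stone_locally_finite x :
  exists r, 0 < r /\
    finite_set (fun u => (exists a n, u = D a n) /\ exists y, u y /\ d x y < r).
Proof.
  destruct (stone_piece_cover x) as [n [a Hx]].
  destruct (stone_piece_open a n x Hx) as [e [He Hball]].
  destruct (half_pow_small e He) as [j Hj].
  (* Two steps shorter than 2^-N then stay below 2^-j < [e], which excludes levels from [N] on, and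
     below the separation 2^-i of each level [i < N]. *)
  set (N := (n + j + 1)%nat).
  exists ((/2)^N). split; [apply half_pow_pos|].
  apply (finite_subset _ (fun u => exists i, (i < N)%nat /\
    ((exists b, u = D b i) /\ exists y, u y /\ d x y < (/2)^N))).
  - intros u [[b [i ->]] [y [Hy Hxy]]].
    exists i. split; [|split; [now exists b|now exists y]].
    destruct (Nat.le_gt_cases N i) as [Hi|]; auto. exfalso.
    destruct Hy as [z [_ [Hz [_ Hzy]]]]. apply Hz.
    apply (stone_union_mono (S n)); [unfold N in Hi; lia|].
    right. exists a. apply Hball.
    pose proof (metric_triangle x y z). rewrite (metric_sym y z) in *.
    pose proof (half_pow_antitone _ _ Hi).
    assert ((/2)^N <= /2 * (/2)^j).
    { change (/2 * (/2)^j) with ((/2)^(S j)). apply half_pow_antitone.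
      unfold N; lia. }
    lra.
  - apply finite_lt_union. intros i Hi. apply finite_at_most_one.
    intros u v [[b ->] [y [Hy Hxy]]] [[c ->] [z [Hz Hxz]]].
    destruct (classic (b = c)) as [->|Hbc]; auto. exfalso.
    pose proof (stone_pieces_separated b c i y z Hbc Hy Hz).
    pose proof (metric_triangle y x z). rewrite (metric_sym y x) in *.
    assert ((/2)^N <= /2 * (/2)^i).
    { change (/2 * (/2)^i) with ((/2)^(S i)). apply half_pow_antitone. lia. }
    lra.
Qed.

End Stone.

Lemma fine_locally_finite_cover (eps : R) : 0 < eps ->
  exists P : set (set M),
    (forall u, P u -> metric_open d u) /\
    (forall x, exists u, P u /\ u x) /\
    (forall u, P u -> forall p q, u p -> u q -> d p q < eps) /\
    (forall x, exists r, 0 < r /\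
       finite_set (fun u => P u /\ exists y, u y /\ d x y < r)).
Proof.
  intros Heps. destruct (well_order_exists M) as [R [HR1 HR2]].
  exists (fun u => exists a n, u = stone_piece R eps (stone_union R eps n) a n).
  split; [|split; [|split]].
  - intros u [a [n ->]]. apply stone_piece_open.
  - intros x. destruct (stone_piece_cover R HR1 eps Heps x) as [n [a H]].
    eexists; split; [|exact H]. now exists a, n.
  - intros u [a [n ->]] p q. now apply stone_piece_mesh with (R := R).
  - apply stone_locally_finite; auto.
Qed.

Lemma fine_locally_finite_covers :
  exists P : nat -> set (set M),
    (forall n u, P n u -> metric_open d u) /\
    (forall n x, exists u, P n u /\ u x) /\
    (forall n u, P n u -> forall p q, u p -> u q -> d p q < (/2)^n) /\
    (forall n x, exists r, 0 < r /\
       finite_set (fun u => P n u /\ exists y, u y /\ d x y < r)).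
Proof.
  destruct (choice_fun _ (fun n => fine_locally_finite_cover ((/2)^n) (half_pow_pos n)))
    as [P HP].
  exists P. repeat split; intros n; apply HP.
Qed.

End Metric.

(** * The Baire metric on sequences *)

Section SequenceMetric.
Context {A : Type}.

(** Equality in [A] need not be decidable, so the distance is first specified and then chosen.
    Strong induction finds the first index of disagreement. *)
Lemma seq_dist_exists (s t : nat -> A) : exists r : R, (s = t /\ r = 0) \/
  exists k, s k <> t k /\ (forall i, (i < k)%nat -> s i = t i) /\ r = (/2)^k.
Proof.
  destruct (classic (s = t)) as [Heq|Hne]; [exists 0; now left|].
  assert (H : exists n, s n <> t n).
  { apply NNPP; intros Hn. apply Hne, functional_extensionality. intros n.
    apply NNPP; intros Hsn. apply Hn; now exists n. }
  destruct H as [n Hn]. revert Hn. induction n as [n IH] using (well_founded_ind Nat.lt_wf_0). intros Hn.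
  destruct (classic (exists i, (i < n)%nat /\ s i <> t i)) as [[i [Hi Hsi]]|Hmin].
  - now apply (IH i).
  - exists ((/2)^n). right. exists n. repeat split; auto.
    intros i Hi. apply NNPP; intros Hsi. apply Hmin; now exists i.
Qed.

Definition seq_dist (s t : nat -> A) : R :=
  proj1_sig (constructive_indefinite_description _ (seq_dist_exists s t)).

Lemma seq_dist_spec (s t : nat -> A) : (s = t /\ seq_dist s t = 0) \/
  exists k, s k <> t k /\ (forall i, (i < k)%nat -> s i = t i) /\ seq_dist s t = (/2)^k.
Proof. apply (proj2_sig (constructive_indefinite_description _ (seq_dist_exists s t))). Qed.

Lemma seq_dist_nonneg s t : 0 <= seq_dist s t.
Proof.
  destruct (seq_dist_spec s t) as [[_ ->]|[k [_ [_ ->]]]]; [lra|].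
  pose proof (half_pow_pos k); lra.
Qed.

Lemma seq_dist_zero s t : seq_dist s t = 0 <-> s = t.
Proof.
  destruct (seq_dist_spec s t) as [[H ->]|[k [Hk [_ ->]]]]; [tauto|].
  pose proof (half_pow_pos k). split; [lra|]. intros ->. now destruct Hk.
Qed.

(** Strictness puts the first difference after [n], so index [n] itself belongs to the agreement. *)
Lemma seq_dist_lt s t n :
  seq_dist s t < (/2)^n <-> forall i, (i <= n)%nat -> s i = t i.
Proof.
  destruct (seq_dist_spec s t) as [[-> ->]|[k [Hk [Hlt ->]]]].
  - pose proof (half_pow_pos n). tauto.
  - destruct (Nat.le_gt_cases k n) as [Hkn|Hkn].
    + pose proof (half_pow_antitone _ _ Hkn). split; [lra|].
      intros H'. now destruct (Hk (H' k Hkn)).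
    + split.
      * intros _ i Hi. apply Hlt; lia.
      * intros _. assert ((/2)^k <= /2 * (/2)^n) by exact (half_pow_antitone (S n) k Hkn).
        pose proof (half_pow_pos n). lra.
Qed.

Lemma seq_dist_ge s t k : s k <> t k -> (/2)^k <= seq_dist s t.
Proof.
  intros H. apply Rnot_lt_le. intros Hlt. apply H.
  now apply (seq_dist_lt s t k).
Qed.

(** Where [s] and [u] first differ, [t] differs from one of them, so one summand on the right is
    already large enough. *)
Lemma seq_dist_triangle s t u : seq_dist s u <= seq_dist s t + seq_dist t u.
Proof.
  pose proof (seq_dist_nonneg s t). pose proof (seq_dist_nonneg t u).
  destruct (seq_dist_spec s u) as [[_ ->]|[k [Hk [_ ->]]]]; [lra|].
  destruct (classic (s k = t k)) as [Hst|Hst].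
  - assert (Htu : t k <> u k) by congruence.
    pose proof (seq_dist_ge _ _ _ Htu). lra.
  - pose proof (seq_dist_ge _ _ _ Hst). lra.
Qed.

Lemma seq_dist_le_sym s t : seq_dist s t <= seq_dist t s.
Proof.
  pose proof (seq_dist_nonneg t s).
  destruct (seq_dist_spec s t) as [[_ ->]|[k [Hk [_ ->]]]]; [lra|].
  apply seq_dist_ge. congruence.
Qed.

Lemma seq_dist_sym s t : seq_dist s t = seq_dist t s.
Proof. apply Rle_antisym; apply seq_dist_le_sym. Qed.

End SequenceMetric.

(** * Developments at the non-isolated points *)

Definition singleton {X : Type} (x : X) : set X := fun y => y = x.

Section Space.
Context {X : Type} (op : set X -> Prop) (Htop : is_topology op) (HT1 : T1_space op).

Lemma open_local (W : set X) :
  (forall x, W x -> exists U, op U /\ U x /\ subset U W) -> op W.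
Proof.
  intros H.
  replace W with (fun x => exists U, (op U /\ subset U W) /\ U x).
  - apply (top_union _ Htop). now intros U [HU _].
  - apply set_ext. intros x; split.
    + intros [U [[_ HU] Hx]]; auto.
    + intros Hx. destruct (H x Hx) as [U [H1 [H2 H3]]]. now exists U.
Qed.

Lemma open_le_inter (U : nat -> set X) (n : nat) :
  (forall i, op (U i)) -> op (fun x => forall i, (i <= n)%nat -> U i x).
Proof.
  intros HU. induction n as [|n IH].
  - replace (fun x => _) with (U O); auto.
    apply set_ext; intros x; split; [|now auto].
    intros Hx i Hi. now replace i with O by lia.
  - pose proof (top_inter _ Htop _ _ IH (HU (S n))) as H.
    erewrite set_ext; [exact H|]. intros x; split.
    + intros Hx; split; [intros i Hi|]; apply Hx; lia.
    + intros [Hx Hx'] i Hi. destruct (Nat.eq_dec i (S n)) as [->|]; auto.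
      apply Hx; lia.
Qed.

Lemma open_complement_point (y : X) : op (fun x => x <> y).
Proof.
  apply open_local. intros x Hx. destruct (HT1 x y Hx) as [U [H1 [H2 H3]]].
  exists U. repeat split; auto. intros z Hz ->. contradiction.
Qed.

Lemma singleton_isolated_neq (x y : X) :
  ~ isolated op x -> isolated op y -> ~ singleton y x.
Proof. intros Hx Hy Hxy. unfold singleton in Hxy. now subst. Qed.

(** Each [b] has a second point because [x] is not isolated. Removing one such point per [b] from
    [U] leaves an open neighborhood of [x], as points are closed. *)
Lemma shrink_avoiding (x : X) (l : list (set X)) (U : set X) :
  ~ isolated op x -> op U -> U x ->
  (forall b, In b l -> op b /\ b x) ->
  exists V, op V /\ V x /\ subset V U /\ forall b, In b l -> ~ subset b V.
Proof.
  intros Hx HU HUx. induction l as [|b l IH]; intros Hl.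
  - exists U. split; [|split; [|split]]; auto.
    now intros y.
  - destruct IH as [V [H1 [H2 [H3 H4]]]]. { intros c Hc; apply Hl; now right. }
    destruct (Hl b) as [Hb Hbx]; [now left|].
    assert (Hy : exists y, b y /\ y <> x).
    { apply NNPP; intros Hn. apply Hx. unfold isolated.
      replace (fun y => y = x) with b; auto. apply set_ext; intros y; split.
      - intros Hy; apply NNPP; intros Hyx; apply Hn; now exists y.
      - now intros ->. }
    destruct Hy as [y [Hby Hyx]].
    exists (fun z => V z /\ z <> y). split; [|split; [|split]]; auto.
    + apply (top_inter _ Htop); auto. apply open_complement_point.
    + intros z [Hz _]; auto.
    + intros c [<-|Hc] Hs.
      * now destruct (Hs y Hby).
      * apply (H4 c Hc). intros z Hz; now apply Hs.
Qed.

(** Levels need not refine earlier ones, so [dev_star] bounds every level from [n0] on. *)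
Record nonisolated_development (G : nat -> set (set X)) : Prop := {
  dev_open : forall n g, G n g -> op g;
  dev_cover : forall n x, ~ isolated op x -> exists g, G n g /\ g x;
  dev_finite : forall n x, ~ isolated op x -> finite_set (fun g => G n g /\ g x);
  dev_star : forall x, ~ isolated op x -> forall U, op U -> U x ->
    exists n0, forall n g, (n0 <= n)%nat -> G n g -> g x -> subset g U
}.

(** The singletons make each level cover the whole space and contain no non-isolated point, so
    finiteness and shrinking there are unaffected. *)
Definition completed (G : nat -> set (set X)) (n : nat) : set (set X) :=
  fun g => G n g \/ exists x, isolated op x /\ g = singleton x.

Section Development.
Context (G : nat -> set (set X)) (HG : nonisolated_development G).

Lemma completed_open n g : completed G n g -> op g.
Proof. intros [H|[x [H ->]]]; [now apply (dev_open _ HG n)|exact H]. Qed.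

Lemma completed_nonisolated n g x :
  ~ isolated op x -> completed G n g -> g x -> G n g.
Proof.
  intros Hx [H|[y [Hy ->]]] Hg; auto. now apply singleton_isolated_neq in Hg.
Qed.

Lemma completed_singleton n x : isolated op x -> completed G n (singleton x).
Proof. intros H; right; now exists x. Qed.

Lemma completed_cover n x : exists g, completed G n g /\ g x.
Proof.
  destruct (classic (isolated op x)) as [H|H].
  - exists (singleton x). split; [now apply completed_singleton|reflexivity].
  - destruct (dev_cover _ HG n x H) as [g [H1 H2]]. exists g; split; auto. now left.
Qed.

Lemma completed_point_countable :
  (forall n, point_countable (G n)) -> forall n, point_countable (completed G n).
Proof.
  intros Hc n x. destruct (Hc n x) as [e He].
  exists (fun k => match k with O => singleton x | S k => e k end).
  intros g [[Hg|[y [Hy ->]]] Hx].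
  - destruct (He g) as [k Hk]; auto. now exists (S k).
  - exists O. unfold singleton in *. now subst.
Qed.

Lemma development_base : is_base op (fun b => exists n, completed G n b).
Proof.
  split.
  - intros b [n Hb]; now apply completed_open in Hb.
  - intros U x HU Hx. destruct (classic (isolated op x)) as [H|H].
    + exists (singleton x). split; [|split].
      * exists O; now apply completed_singleton.
      * reflexivity.
      * now intros y ->.
    + destruct (dev_star _ HG x H U HU Hx) as [n Hn].
      destruct (dev_cover _ HG n x H) as [g [H1 H2]].
      exists g. split; [|split]; auto.
      * exists n; now left.
      * now apply (Hn n).
Qed.

(** Members through [x] that leave [U] come only from levels below [n0], each of which is finite at
    [x]. *)
Lemma development_base_regular :
  point_regular_nonisolated op (fun b => exists n, completed G n b).
Proof.
  intros x Hx U HU HUx. destruct (dev_star _ HG x Hx U HU HUx) as [n0 Hn0].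
  apply (finite_subset _ (fun g => exists n, (n < n0)%nat /\ (G n g /\ g x))).
  - intros g [[n Hg] [Hgx HgU]]. apply completed_nonisolated with (x := x) in Hg; auto.
    exists n. repeat split; auto.
    destruct (Nat.le_gt_cases n0 n) as [Hle|]; auto.
    exfalso; apply HgU. now apply (Hn0 n).
  - apply finite_lt_union. intros n _. now apply (dev_finite _ HG).
Qed.

Lemma development_base_countable :
  (forall n, point_countable (G n)) ->
  point_countable (fun b => exists n, completed G n b).
Proof.
  intros Hc x.
  apply (countable_subset _ (fun b => exists n, completed G n b /\ b x)).
  - intros b [[n Hb] Hx]; now exists n.
  - apply countable_nat_union. intros n. now apply completed_point_countable.
Qed.

(* Each member of the n-th level is replaced by the union of those members of a
   point-countable refinement that are assigned to it. *)
Lemma metalindelof_development : metalindelof op ->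
  exists G', nonisolated_development G' /\ forall n, point_countable (G' n).
Proof.
  intros Hm.
  assert (HR : forall n, exists Rf, open_cover op Rf /\ refines Rf (completed G n) /\
    point_countable Rf).
  { intros n. apply Hm. split; [apply completed_open|apply completed_cover]. }
  destruct (choice_fun _ HR) as [Rf HRf].
  (* Choosing over pairs serves all levels at once; outside [Rf n] the value is a dummy. *)
  assert (Hphi : forall (nv : nat * set X), exists g, Rf (fst nv) (snd nv) ->
    completed G (fst nv) g /\ subset (snd nv) g).
  { intros [n v]. cbn. destruct (classic (Rf n v)) as [Hv|Hv].
    - destruct (HRf n) as [_ [Href _]]. destruct (Href v Hv) as [g Hg]. now exists g.
    - exists v. contradiction. }
  destruct (choice_fun _ Hphi) as [phi0 Hphi0]. clear Hphi HR.
  pose (phi := fun n v => phi0 (n, v)).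
  assert (Hphi : forall n v, Rf n v -> completed G n (phi n v) /\ subset v (phi n v)).
  { intros n v. apply (Hphi0 (n, v)). }
  clearbody phi. clear phi0 Hphi0.
  pose (shrunk := fun n (g : set X) (y : X) => exists v, Rf n v /\ phi n v = g /\ v y).
  assert (Hsub : forall n g, subset (shrunk n g) g).
  { intros n g y [v [Hv [<- Hy]]]. now apply (Hphi n v Hv). }
  exists (fun n h => exists g, G n g /\ shrunk n g = h). split; [split|].
  - intros n h [g [Hg <-]]. apply open_local. intros y [v [Hv [Hvg Hy]]].
    destruct (HRf n) as [[Hop _] _].
    exists v. repeat split; auto. intros z Hz. now exists v.
  - intros n x Hx. destruct (HRf n) as [[_ Hcov] _].
    destruct (Hcov x) as [v [Hv Hvx]]. destruct (Hphi n v Hv) as [Hg Hvg].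
    exists (shrunk n (phi n v)). split.
    + exists (phi n v). split; auto. apply completed_nonisolated with (x := x); auto.
    + now exists v.
  - intros n x Hx.
    apply (finite_subset _ (fun h => exists g, (G n g /\ g x) /\ shrunk n g = h)).
    + intros h [[g [Hg <-]] Hxg]. exists g. repeat split; auto. now apply (Hsub n).
    + apply finite_image. now apply (dev_finite _ HG).
  - intros x Hx U HU HUx. destruct (dev_star _ HG x Hx U HU HUx) as [n0 Hn0].
    exists n0. intros n h Hn [g [Hg <-]] Hgx y Hy.
    apply (Hn0 n g Hn Hg); now apply (Hsub n).
  (* A shrunken set through [x] is determined by any refinement member through [x] assigned to it,
     and these are countably many. *)
  - intros n x.
    apply (countable_subset _ (fun h => exists v, (Rf n v /\ v x) /\ shrunk n (phi n v) = h)).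
    + intros h [[g [Hg <-]] [v [Hv [Hvg Hx]]]]. exists v. now rewrite Hvg.
    + apply countable_image. apply HRf.
Qed.

End Development.

Lemma point_countable_base_metalindelof (B : set (set X)) :
  is_base op B -> point_countable B -> metalindelof op.
Proof.
  intros [HB1 HB2] Hpc C [HC1 HC2].
  exists (fun b => B b /\ exists U, C U /\ subset b U). split; [split|split].
  - intros b [Hb _]; auto.
  - intros x. destruct (HC2 x) as [U [HU Hx]].
    destruct (HB2 U x (HC1 U HU) Hx) as [b [H1 [H2 H3]]].
    exists b. repeat split; auto. now exists U.
  - now intros b [_ H].
  - intros x. apply (countable_subset _ (fun b => B b /\ b x)); auto.
    now intros b [[Hb _] Hx].
Qed.

(** * Layers of maximal members of a point-regular base *)

Definition maximal_in (F : set (set X)) (b : set X) : Prop :=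
  F b /\ forall b', F b' -> subset b b' -> subset b' b.

Fixpoint peel (B : set (set X)) (n : nat) : set (set X) :=
  match n with
  | O => B
  | S n => fun b => peel B n b /\ ~ maximal_in (peel B n) b
  end.

Section Peel.
Context (B : set (set X)) (HB : is_base op B) (Hreg : point_regular_nonisolated op B).

Lemma peel_antitone n m : (n <= m)%nat -> subset (peel B m) (peel B n).
Proof.
  induction 1 as [|m H IH]; intros b Hb; auto. apply IH, Hb.
Qed.

Lemma peel_base n b : peel B n b -> B b.
Proof. apply (peel_antitone 0 n); lia. Qed.

(** Regularity with [b] as the neighborhood leaves finitely many members through [x] not contained
    in [b]. Passing to a strictly larger member shortens this list, so the ascent stops. *)
Lemma maximal_above n x b :
  ~ isolated op x -> peel B n b -> b x -> exists m, maximal_in (peel B n) m /\ m x.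
Proof.
  intros Hx Hb Hbx.
  destruct (Hreg x Hx b) as [l Hl]; auto. { apply HB, (peel_base n), Hb. }
  assert (Hl' : forall b', peel B n b' -> b' x -> ~ subset b' b -> In b' l).
  { intros b' H1 H2 H3. apply Hl. repeat split; auto. now apply (peel_base n). }
  clear Hl. remember (length l) as k eqn:Hk.
  revert b l Hb Hbx Hl' Hk. induction k as [|k IH]; intros b l Hb Hbx Hl Hk.
  - exists b. repeat split; auto. intros b' Hb' Hs. apply NNPP; intros Hn.
    destruct l; [|discriminate]. apply (Hl b'); auto.
  - destruct (classic (maximal_in (peel B n) b)) as [Hm|Hm]; [now exists b|].
    assert (Hb' : exists b', peel B n b' /\ subset b b' /\ ~ subset b' b).
    { apply NNPP; intros Hn. apply Hm. split; auto. intros b' H1 H2.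
      apply NNPP; intros H3. apply Hn; now exists b'. }
    destruct Hb' as [b' [H1 [H2 H3]]].
    destruct (in_split b' l) as [l1 [l2 Hl12]]. { apply Hl; auto. }
    apply (IH b' (l1 ++ l2)); auto.
    + intros c Hc Hcx Hcb'.
      assert (Hin : In c l). { apply Hl; auto. intros Hcb. apply Hcb'. intros y Hy; auto. }
      rewrite Hl12 in Hin. apply in_app_or in Hin. apply in_or_app.
      destruct Hin as [Hin|[<-|Hin]]; auto. exfalso; apply Hcb'. now intros y.
    + rewrite Hl12, length_app in Hk. cbn in Hk. rewrite length_app. lia.
Qed.

(** Fix one maximal [b0] through [x]. Another one inside [b0] equals it; the rest are not contained
    in [b0], and regularity allows finitely many of these. *)
Lemma maximal_finite n x :
  ~ isolated op x -> finite_set (fun b => maximal_in (peel B n) b /\ b x).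
Proof.
  intros Hx.
  destruct (classic (exists b, maximal_in (peel B n) b /\ b x)) as [[b0 [Hb0 Hb0x]]|Hn].
  - destruct (Hreg x Hx b0) as [l Hl]; auto.
    { apply HB, (peel_base n), Hb0. }
    exists (b0 :: l). intros b [Hb Hbx].
    destruct (classic (subset b b0)) as [Hs|Hs].
    + left. apply set_ext. intros y; split; auto. apply Hb; auto. apply Hb0.
    + right. apply Hl. repeat split; auto. apply (peel_base n), Hb.
  - exists nil. intros b Hb. apply Hn. now exists b.
Qed.

(** Shrink [U] until it contains none of the finitely many maximal members through [x]; a member
    inside the smaller set is not maximal and survives the next peeling. *)
Lemma peel_local_base n x U :
  ~ isolated op x -> op U -> U x -> exists b, peel B n b /\ b x /\ subset b U.
Proof.
  intros Hx. revert U. induction n as [|n IH]; intros U HU HUx.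
  - now apply HB.
  - destruct (maximal_finite n x Hx) as [l Hl].
    (* The bounding list [l] may hold other sets as well; the filter keeps those known to be open
       neighborhoods of [x]. *)
    destruct (shrink_avoiding x (filter (fun b =>
      if excluded_middle_informative (maximal_in (peel B n) b /\ b x) then true else false) l) U)
      as [V [H1 [H2 [H3 H4]]]]; auto.
    { intros b Hb. apply filter_In in Hb. destruct Hb as [_ Hb].
      destruct excluded_middle_informative as [[Hm Hbx]|]; [|discriminate].
      split; auto. apply HB, (peel_base n), Hm. }
    destruct (IH V H1 H2) as [b [Hb [Hbx HbV]]].
    exists b. repeat split; auto.
    + intros Hm. apply (H4 b); auto. apply filter_In. split; [now apply Hl|].
      destruct excluded_middle_informative as [|Hn]; auto.
    + intros y Hy; auto.
Qed.

(** For [dev_star]: finitely many members through [x] leave [U], and each is maximal at one stage at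
    most, since it is then removed. *)
Lemma peel_development : nonisolated_development (fun n => maximal_in (peel B n)).
Proof.
  split.
  - intros n g Hg. apply HB, (peel_base n), Hg.
  - intros n x Hx. destruct (peel_local_base n x (fun _ => True)) as [b [H1 [H2 _]]]; auto.
    { apply Htop. }
    now apply (maximal_above n x b).
  - intros n x Hx. now apply maximal_finite.
  - intros x Hx U HU HUx. destruct (Hreg x Hx U HU HUx) as [l Hl].
    assert (Hbound : exists n0, forall b, In b l -> forall n, (n0 <= n)%nat ->
      ~ maximal_in (peel B n) b).
    { clear Hl. induction l as [|b l [n0 IH]].
      - exists O. intros b [].
      - destruct (classic (exists k, maximal_in (peel B k) b)) as [[k Hk]|Hn].
        + exists (Nat.max n0 (S k)). intros c [<-|Hc] n Hn Hm.
          * destruct Hm as [Hm _]. apply (peel_antitone (S k) n) in Hm; [|lia].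
            now destruct Hm.
          * apply (IH c Hc n); auto. lia.
        + exists n0. intros c [<-|Hc] n Hle Hm.
          * apply Hn; now exists n.
          * now apply (IH c Hc n). }
    destruct Hbound as [n0 Hn0]. exists n0. intros n g Hn Hg Hgx.
    apply NNPP; intros Hs. apply (Hn0 g) with (n := n); auto.
    apply Hl. repeat split; auto. apply (peel_base n), Hg.
Qed.

End Peel.

(** * Open images of metric spaces *)

Section Image.
Context {M : Type} (d : M -> M -> R) (Hd : is_metric d) (f : M -> X).
Context (Hcont : continuous_map (metric_open d) op f) (Hsurj : surjective_map f)
  (Hopen : open_map (metric_open d) op f).

Definition image_set (u : set M) : set X := fun x => exists m, u m /\ f m = x.

(** The fiber is closed by continuity and T1. A nonempty open set inside it would have the singleton
    of [x] as its open image. *)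
Lemma boundary_fiber_nonisolated (x : X) :
  ~ isolated op x -> boundary (metric_open d) (fiber f x) = fiber f x.
Proof.
  intros Hx. apply set_ext. intros m; split.
  - intros [Hcl _]. apply NNPP; intros Hm.
    destruct (Hcl (fun p => f p <> x)) as [p [Hp Hpx]].
    + apply (Hcont (fun y => y <> x)). apply open_complement_point.
    + exact Hm.
    + contradiction.
  - intros Hm; split.
    + intros U HU HUm. now exists m.
    + intros [U [HU [HUm HUx]]]. apply Hx. unfold isolated.
      replace (fun y => y = x) with (image_set U); [now apply Hopen|].
      apply set_ext. intros y; split.
      * intros [p [Hp <-]]. now apply HUx.
      * intros ->. now exists m.
Qed.

(** Continuity makes the images of small cover members a base. A member meeting a fiber contains a
    point of its countable dense set, where local finiteness leaves finitely many candidates per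
    level. *)
Lemma open_s_image_point_countable_base :
  s_map (metric_open d) f -> exists B, is_base op B /\ point_countable B.
Proof.
  intros Hsep. destruct (fine_locally_finite_covers d Hd) as [P [P1 [P2 [P3 P4]]]].
  exists (fun b => exists n u, P n u /\ image_set u = b). split; [split|].
  - intros b [n [u [Hu <-]]]. now apply Hopen, (P1 n).
  - intros U x HU Hx. destruct (Hsurj x) as [m <-].
    destruct (Hcont U HU m Hx) as [e [He Hball]].
    destruct (half_pow_small e He) as [n Hn].
    destruct (P2 n m) as [u [Hu Hum]].
    exists (image_set u). split; [now exists n, u|split; [now exists m|]].
    intros y [p [Hp <-]]. apply Hball. pose proof (P3 n u Hu m p Hum Hp). lra.
  - intros x. destruct (Hsep x) as [D [HD1 [[g Hg] HD3]]].
    apply (countable_subset _ (fun b => exists n k, exists u,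
      (P n u /\ u (g k)) /\ image_set u = b)).
    + intros b [[n [u [Hu <-]]] [m [Hm Hmx]]].
      destruct (HD3 m u Hmx (P1 n u Hu) Hm) as [p [Hp Hpu]].
      destruct (Hg p Hp) as [k <-]. now exists n, k, u.
    + apply countable_nat_union; intros n. apply countable_nat_union; intros k.
      apply countable_image. apply (finite_countable (fun _ => True)).
      destruct (P4 n (g k)) as [r [Hr Hfin]]. revert Hfin. apply finite_subset.
      intros u [Hu Huk]. split; auto. exists (g k). split; auto.
      now rewrite metric_refl.
Qed.

Lemma compact_meets_finitely_many (K : set M) (P : set (set M)) :
  compact_subset (metric_open d) K ->
  (forall x, exists r, 0 < r /\
     finite_set (fun u => P u /\ exists y, u y /\ d x y < r)) ->
  finite_set (fun u => P u /\ exists m, K m /\ u m).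
Proof.
  intros HK HP.
  destruct (HK (fun V => metric_open d V /\ finite_set (fun u => P u /\ exists y, u y /\ V y)))
    as [l [Hl1 Hl2]].
  - now intros U [HU _].
  - intros m _. destruct (HP m) as [r [Hr Hfin]].
    exists (fun y => d m y < r). split; [split|]; auto.
    + now apply metric_ball_open.
    + now rewrite metric_refl.
  - apply (finite_subset _ (fun u => exists V, In V l /\ (P u /\ exists y, u y /\ V y))).
    + intros u [Hu [m [Hm Hum]]]. destruct (Hl2 m Hm) as [V [HV HVm]].
      exists V. repeat split; auto. now exists m.
    + apply finite_list_union. intros V HV. now apply Hl1.
Qed.

(** A Lebesgue number argument: the least radius of a finite subcover works. Balls of half the
    available radius leave the other half for the move from [p] to [q]. *)
Lemma compact_uniform_neighborhood (K W : set M) :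
  compact_subset (metric_open d) K -> metric_open d W -> subset K W ->
  exists e, 0 < e /\ forall m, K m -> forall q, d m q < e -> W q.
Proof.
  intros HK HW HKW.
  destruct (HK (fun V => metric_open d V /\
    exists e, 0 < e /\ forall p, V p -> forall q, d p q < e -> W q)) as [l [Hl1 Hl2]].
  - now intros U [HU _].
  - intros m Hm. destruct (HW m (HKW m Hm)) as [e [He Hball]].
    exists (fun y => d m y < e / 2). split; [split|].
    + now apply metric_ball_open.
    + exists (e / 2). split; [lra|]. intros p Hp q Hq. apply Hball.
      pose proof (metric_triangle d Hd m p q). lra.
    + rewrite metric_refl; auto. lra.
  - assert (He : exists e, 0 < e /\ forall V, In V l -> forall p, V p ->
      forall q, d p q < e -> W q).
    { clear Hl2. induction l as [|V l IH].
      - exists 1. split; [lra|]. intros V [].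
      - destruct IH as [e1 [He1 H1]]. { intros U HU; apply Hl1; now right. }
        destruct (Hl1 V) as [_ [e2 [He2 H2]]]; [now left|].
        exists (Rmin e1 e2). split; [now apply Rmin_pos|].
        pose proof (Rmin_l e1 e2). pose proof (Rmin_r e1 e2).
        intros U [<-|HU] p Hp q Hq.
        + apply (H2 p Hp). lra.
        + apply (H1 U HU p Hp). lra. }
    destruct He as [e [He H]]. exists e. split; auto.
    intros m Hm. destruct (Hl2 m Hm) as [V [HV HVm]]. now apply (H V).
Qed.

(** Compact fibers give [dev_finite]. For [dev_star], the fiber has a uniform radius inside the
    preimage of [U]; once 2^-n is below it, cover members meeting the fiber map into [U]. *)
Lemma open_boundary_compact_image_development :
  boundary_compact_map (metric_open d) f -> exists G, nonisolated_development G.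
Proof.
  intros Hbc. destruct (fine_locally_finite_covers d Hd) as [P [P1 [P2 [P3 P4]]]].
  assert (HK : forall x, ~ isolated op x -> compact_subset (metric_open d) (fiber f x)).
  { intros x Hx. rewrite <- boundary_fiber_nonisolated; auto. }
  exists (fun n g => exists u, P n u /\ image_set u = g). split.
  - intros n g [u [Hu <-]]. now apply Hopen, (P1 n).
  - intros n x _. destruct (Hsurj x) as [m <-]. destruct (P2 n m) as [u [Hu Hum]].
    exists (image_set u). split; [now exists u|now exists m].
  - intros n x Hx.
    apply (finite_subset _ (fun g => exists u,
      (P n u /\ exists m, fiber f x m /\ u m) /\ image_set u = g)).
    + intros g [[u [Hu <-]] [m [Hm Hmx]]]. exists u. repeat split; auto. now exists m.
    + apply finite_image. now apply compact_meets_finitely_many; [apply HK|].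
  - intros x Hx U HU HUx.
    destruct (compact_uniform_neighborhood (fiber f x) (fun m => U (f m)))
      as [e [He Hunif]]; auto.
    { now intros m ->. }
    destruct (half_pow_small e He) as [n0 Hn0]. exists n0.
    intros n g Hn [u [Hu <-]] [m [Hm Hmx]] y [q [Hq <-]].
    apply (Hunif m Hmx).
    pose proof (P3 n u Hu m q Hm Hq). pose proof (half_pow_antitone _ _ Hn). lra.
Qed.

End Image.

(** * The space of convergent sequences of a development *)

Section Ponomarev.
Context (G : nat -> set (set X)) (HG : nonisolated_development G).

(** The limit point is stored with the sequence, so that the map to [X] is a projection; the metric
    looks at the sequence only. *)
Definition local_sequence (p : (nat -> set X) * X) : Prop :=
  (forall n, completed G n (fst p n) /\ fst p n (snd p)) /\
  forall U, op U -> U (snd p) -> exists n, subset (fst p n) U.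

Definition sequence_space : Type := {p | local_sequence p}.

Definition seq_of (m : sequence_space) : nat -> set X := fst (proj1_sig m).

Definition point_of (m : sequence_space) : X := snd (proj1_sig m).

Definition sequence_dist (m m' : sequence_space) : R := seq_dist (seq_of m) (seq_of m').

Lemma seq_of_mem m n : seq_of m n (point_of m).
Proof. apply (proj2_sig m). Qed.

Lemma seq_of_completed m n : completed G n (seq_of m n).
Proof. apply (proj2_sig m). Qed.

Lemma seq_of_shrinks m U : op U -> U (point_of m) -> exists n, subset (seq_of m n) U.
Proof. apply (proj2_sig m). Qed.

(** Every entry of a common sequence contains both points, yet some entry fits into a neighborhood
    of one that misses the other. This lets a distance that ignores the points separate elements. *)
Lemma seq_of_inj m m' : seq_of m = seq_of m' -> m = m'.
Proof.
  intros H. assert (Hp : point_of m = point_of m').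
  { apply NNPP; intros Hn. destruct (HT1 _ _ Hn) as [U [HU [HUm HUm']]].
    destruct (seq_of_shrinks m U HU HUm) as [n Hsub].
    apply HUm', Hsub. rewrite H. apply seq_of_mem. }
  destruct m as [[s x] Hm], m' as [[s' x'] Hm']. cbn in *. subst.
  f_equal. apply proof_irrelevance.
Qed.

Lemma sequence_dist_metric : is_metric sequence_dist.
Proof.
  split; [|split; [|split]].
  - intros; apply seq_dist_nonneg.
  - intros m m'. unfold sequence_dist. rewrite seq_dist_zero. split.
    + apply seq_of_inj.
    + now intros ->.
  - intros; apply seq_dist_sym.
  - intros; apply seq_dist_triangle.
Qed.

Let openM := metric_open sequence_dist.

Lemma prefix_ball (m : sequence_space) (U : set sequence_space) :
  openM U -> U m ->
  exists n, forall m', (forall i, (i <= n)%nat -> seq_of m i = seq_of m' i) -> U m'.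
Proof.
  intros HU Hm. destruct (HU m Hm) as [e [He Hball]].
  destruct (half_pow_small e He) as [n Hn]. exists n.
  intros m' Hm'. apply Hball. apply (seq_dist_lt _ _ n) in Hm'.
  unfold sequence_dist. lra.
Qed.

Lemma prefix_of_close (m m' : sequence_space) n :
  sequence_dist m m' < (/2)^n -> seq_of m n = seq_of m' n.
Proof. intros H. apply (seq_dist_lt _ _ n); auto. Qed.

(** Past the prefix, singletons force convergence at an isolated [x]; at a non-isolated one
    [dev_star] does so for any continuation. *)
Lemma extend_prefix (x : X) (s : nat -> set X) (n : nat) :
  (forall i, (i <= n)%nat -> completed G i (s i) /\ s i x) ->
  exists m, point_of m = x /\ forall i, (i <= n)%nat -> seq_of m i = s i.
Proof.
  intros Hs.
  assert (Hc : exists c : nat -> set X, forall i, (completed G i (c i) /\ c i x) /\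
    (isolated op x -> c i = singleton x)).
  { apply choice_fun with (R := fun i g => (completed G i g /\ g x) /\
      (isolated op x -> g = singleton x)). intros i.
    destruct (classic (isolated op x)) as [H|H].
    - exists (singleton x). repeat split. now apply completed_singleton.
    - destruct (completed_cover G HG i x) as [g Hg]. exists g. now split. }
  destruct Hc as [c Hc].
  pose (t := fun i => if Nat.leb i n then s i else c i).
  assert (Ht : forall i, (i <= n)%nat -> t i = s i).
  { intros i Hi. unfold t. now rewrite (proj2 (Nat.leb_le i n) Hi). }
  assert (Ht' : forall i, (n < i)%nat -> t i = c i).
  { intros i Hi. unfold t. now rewrite (proj2 (Nat.leb_gt i n) Hi). }
  assert (Hloc : local_sequence (t, x)).
  { assert (Hmem : forall i, completed G i (t i) /\ t i x).
    { intros i. destruct (Nat.le_gt_cases i n) as [Hi|Hi].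
      - rewrite Ht; auto.
      - rewrite Ht'; auto. apply Hc. }
    split; [exact Hmem|]. cbn. intros U HU HUx.
    destruct (classic (isolated op x)) as [H|H].
    (* [S n] is the first index past the prefix, where the entry is the singleton. *)
    - exists (S n). rewrite Ht'; auto. destruct (Hc (S n)) as [_ Hi]. rewrite Hi; auto.
      now intros y ->.
    - destruct (dev_star _ HG x H U HU HUx) as [n0 Hn0].
      exists n0. destruct (Hmem n0) as [H1 H2].
      apply (Hn0 n0); auto. now apply completed_nonisolated with (x := x). }
  exists (exist _ (t, x) Hloc). split; auto.
Qed.

Lemma point_of_continuous : continuous_map openM op point_of.
Proof.
  intros V HV m Hm. destruct (seq_of_shrinks m V HV Hm) as [n Hn].
  exists ((/2)^n). split; [apply half_pow_pos|]. intros m' Hm'.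
  apply Hn. rewrite (prefix_of_close _ _ _ Hm'). apply seq_of_mem.
Qed.

Lemma point_of_surjective : surjective_map point_of.
Proof.
  intros x. destruct (completed_cover G HG 0 x) as [g Hg].
  destruct (extend_prefix x (fun _ => g) 0) as [m [Hm _]].
  - intros i Hi. now replace i with O by lia.
  - now exists m.
Qed.

(** The intersection of finitely many initial entries is a neighborhood inside the image, since the
    prefix extends over each of its points. *)
Lemma point_of_open : open_map openM op point_of.
Proof.
  intros U HU. apply open_local. intros x [m [Hm <-]].
  destruct (prefix_ball m U HU Hm) as [n Hn].
  exists (fun y => forall i, (i <= n)%nat -> seq_of m i y). split; [|split].
  - apply open_le_inter. intros i. apply (completed_open G HG i), seq_of_completed.
  - intros i _. apply seq_of_mem.
  - intros y Hy. destruct (extend_prefix y (seq_of m) n) as [m' [Hm' Hpre]].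
    + intros i Hi; split; [apply seq_of_completed|auto].
    + exists m'. split; auto. apply Hn. intros i Hi. now rewrite Hpre.
Qed.

(** Over [x] each coordinate ranges over a countable set, so pairs [(n, k)] code all finite
    prefixes; one fiber element per realized code gives a dense set. *)
Lemma point_of_s_map : (forall n, point_countable (G n)) -> s_map openM point_of.
Proof.
  intros Hpc x.
  assert (He : forall n, exists e : nat -> set X,
    forall g, completed G n g /\ g x -> exists k, e k = g).
  { intros n. now apply completed_point_countable. }
  destruct (choice_fun _ He) as [e Hen]. clear He.
  destruct (point_of_surjective x) as [m0 Hm0].
  pose (matches := fun nk m => point_of m = x /\
    forall i, (i < fst nk)%nat -> seq_of m i = e i (decode (snd nk) i)).
  (* Unrealized codes receive the default [m0], which still lies in the fiber. *)
  assert (Hpick : forall nk, exists m, point_of m = x /\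
    ((exists m', matches nk m') -> matches nk m)).
  { intros nk. destruct (classic (exists m', matches nk m')) as [[m' H]|H].
    - exists m'. split; auto. apply H.
    - exists m0. split; auto. contradiction. }
  destruct (choice_fun _ Hpick) as [pick Hpk]. clear Hpick.
  exists (fun m => exists n k, pick (n, k) = m). split; [|split].
  - intros m [n [k <-]]. apply (proj1 (Hpk (n, k))).
  - apply countable_nat_union. intros n. now exists (fun k => pick (n, k)).
  - intros m U Hm HU HUm. destruct (prefix_ball m U HU HUm) as [n Hn].
    assert (Hc : forall i, exists k, e i k = seq_of m i).
    { intros i. apply Hen. split; [apply seq_of_completed|].
      rewrite <- Hm. apply seq_of_mem. }
    destruct (choice_fun _ Hc) as [c Hci].
    (* Codes fix the indices strictly below their length, while [prefix_ball] needs agreement up to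
       [n] inclusive. *)
    destruct (decode_prefix (S n) c) as [k Hk].
    exists (pick (S n, k)). split; [now exists (S n), k|].
    destruct (proj2 (Hpk (S n, k))) as [_ Hmatch].
    + exists m. split; auto. cbn. intros i Hi. now rewrite Hk, Hci.
    + apply Hn. intros i Hi. rewrite Hmatch; cbn; [|lia]. rewrite Hk, Hci; auto; lia.
Qed.

(** * Compactness of fibers and their boundaries *)

Definition finitely_covered (C : set (set sequence_space)) (A : set sequence_space) : Prop :=
  exists l : list (set sequence_space), (forall U, In U l -> C U) /\
    forall m, A m -> exists U, In U l /\ U m.

Lemma finitely_covered_union {I : Type} C (l : list I) (A : I -> set sequence_space) :
  (forall i, In i l -> finitely_covered C (A i)) ->
  finitely_covered C (fun m => exists i, In i l /\ A i m).
Proof.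
  induction l as [|i l IH]; intros H.
  - exists nil. split; [intros U []|intros m [i [[] _]]].
  - destruct (H i) as [l1 [H1 H1']]; [now left|].
    destruct IH as [l2 [H2 H2']]; [intros j Hj; apply H; now right|].
    exists (l1 ++ l2). split.
    + intros U HU. apply in_app_or in HU. destruct HU; auto.
    + intros m [j [[<-|Hj] Hm]].
      * destruct (H1' m Hm) as [U [HU HUm]]. exists U. split; auto.
        apply in_or_app; now left.
      * destruct (H2' m) as [U [HU HUm]]; [now exists j|]. exists U. split; auto.
        apply in_or_app; now right.
Qed.

(* Koenig's argument: a cover without finite subcover yields, coordinate by
   coordinate, a point of the fiber none of whose prefix sets is finitely covered. *)
Lemma fiber_compact (x : X) :
  ~ isolated op x -> compact_subset openM (fiber point_of x).
Proof.
  intros Hx C HC Hcov. apply NNPP. intros Hbad0.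
  pose (cyl := fun (n : nat) (s : nat -> set X) (m : sequence_space) =>
    point_of m = x /\ forall i, (i < n)%nat -> seq_of m i = s i).
  pose (upd := fun (s : nat -> set X) (n : nat) (g : set X) (i : nat) =>
    if Nat.eqb i n then g else s i).
  assert (Hupd : forall s n g, upd s n g n = g).
  { intros. unfold upd. now rewrite Nat.eqb_refl. }
  assert (Hupd' : forall s n g i, i <> n -> upd s n g i = s i).
  { intros s n g i Hi. unfold upd. now rewrite (proj2 (Nat.eqb_neq i n) Hi). }
  assert (Hstep : forall ns, exists g, ~ finitely_covered C (cyl (fst ns) (snd ns)) ->
    ~ finitely_covered C (cyl (S (fst ns)) (upd (snd ns) (fst ns) g))).
  { intros [n s]. cbn [fst snd].
    destruct (classic (exists g, ~ finitely_covered C (cyl (S n) (upd s n g))))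
      as [[g Hg]|Hn]; [now exists g|].
    exists (s n). intros Hbad _. apply Hbad.
    (* Only finitely many sets can be entry [n] over [x]; were all their cylinders finitely covered,
       so would be the cylinder of [s]. *)
    destruct (dev_finite _ HG n x Hx) as [l Hl].
    destruct (finitely_covered_union C l (fun g => cyl (S n) (upd s n g))) as [lC [H1 H2]].
    { intros g _. apply NNPP. intros Hg. apply Hn. now exists g. }
    exists lC. split; auto. intros m [Hm Hpre]. apply H2. exists (seq_of m n). split.
    - apply Hl. pose proof (seq_of_mem m n) as Hmem. rewrite Hm in Hmem. split; auto.
      apply completed_nonisolated with (x := x); auto. apply seq_of_completed.
    - split; auto. intros i Hi. destruct (Nat.eq_dec i n) as [->|Hin].
      + now rewrite Hupd.
      + rewrite Hupd'; auto. apply Hpre; lia. }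
  destruct (choice_fun _ Hstep) as [next Hnext]. clear Hstep.
  (* The starting sequence is arbitrary, as a cylinder of length 0 prescribes no entry. *)
  pose (st := fix st n := match n with
    | O => fun _ => fun _ => True
    | S n => upd (st n) n (next (n, st n)) end : nat -> set X).
  assert (Hst : forall n, ~ finitely_covered C (cyl n (st n))).
  { induction n as [|n IH].
    - intros [l [H1 H2]]. apply Hbad0. exists l. split; auto.
      intros m Hm. apply H2. split; auto. intros i Hi; lia.
    - apply (Hnext (n, st n) IH). }
  assert (Hstable : forall n i, (i < n)%nat -> st n i = st (S i) i).
  { induction n as [|n IH]; intros i Hi; [lia|].
    destruct (Nat.eq_dec i n) as [->|Hin]; auto.
    change (st (S n)) with (upd (st n) n (next (n, st n))).
    rewrite Hupd'; auto. apply IH; lia. }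
  (* The diagonal: entry [i] no longer changes from stage [S i] on. *)
  pose (s := fun i => st (S i) i).
  assert (Hs : forall n, ~ finitely_covered C (cyl n s)).
  { intros n [l [H1 H2]]. apply (Hst n). exists l. split; auto.
    intros m [Hm Hpre]. apply H2. split; auto. intros i Hi. rewrite Hpre; auto. }
  (* The empty list covers an empty cylinder, so some fiber element realizes each prefix of [s]. *)
  assert (Hsm : forall n, completed G n (s n) /\ s n x).
  { intros n. apply NNPP. intros Hn. apply (Hs (S n)). exists nil. split; [intros U []|].
    intros m [Hm Hpre]. exfalso; apply Hn. rewrite <- Hpre; auto. split.
    - apply seq_of_completed.
    - rewrite <- Hm. apply seq_of_mem. }
  assert (Hloc : local_sequence (s, x)).
  { split; [exact Hsm|]. cbn. intros U HU HUx.
    destruct (dev_star _ HG x Hx U HU HUx) as [n0 Hn0].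
    exists n0. destruct (Hsm n0) as [H1 H2]. apply (Hn0 n0); auto.
    now apply completed_nonisolated with (x := x). }
  pose (m := exist _ (s, x) Hloc : sequence_space).
  destruct (Hcov m eq_refl) as [U [HU HUm]].
  (* One member of the cover contains a whole cylinder around the limit, against [Hs]. *)
  destruct (prefix_ball m U (HC U HU) HUm) as [n Hn].
  apply (Hs (S n)). exists (U :: nil). split.
  - now intros V [<-|[]].
  - intros m' [Hm' Hpre]. exists U. split; [now left|]. apply Hn.
    intros i Hi. symmetry. apply Hpre. lia.
Qed.

Lemma point_of_boundary_compact : boundary_compact_map openM point_of.
Proof.
  intros x. destruct (classic (isolated op x)) as [Hx|Hx].
  (* The boundary is empty here: points of the open fiber are interior, and all others lie outside
     its closure. *)
  - intros C _ _. exists nil. split; [intros U []|].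
    intros m [Hcl Hint]. exfalso. destruct (classic (point_of m = x)) as [Hm|Hm].
    + apply Hint. exists (fiber point_of x). split; [|split]; auto.
      * apply (point_of_continuous _ Hx).
      * now intros m'.
    + destruct (Hcl (fun p => point_of p <> x)) as [p [Hp Hpx]]; auto.
      apply (point_of_continuous (fun y => y <> x)). apply open_complement_point.
  - unfold openM. rewrite boundary_fiber_nonisolated; auto.
    + now apply fiber_compact.
    + apply point_of_continuous.
    + apply point_of_open.
Qed.

End Ponomarev.
End Space.

Theorem mainTheorem16 (X : Type) (op : set X -> Prop)
  (Htop : is_topology op) (HT1 : T1_space op) :
  let c1 := (exists B, is_base op B /\ point_countable B) /\
            (exists B, is_base op B /\ point_regular_nonisolated op B) in
  let c2 := exists B, is_base op B /\ point_countable B /\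
                      point_regular_nonisolated op B in
  let c3 := metric_image op (fun M opM f =>
              open_map opM op f /\ boundary_compact_map opM f /\ s_map opM f) in
  let c4 := metric_image op (fun M opM f => open_map opM op f /\ s_map opM f) /\
            metric_image op (fun M opM f =>
              open_map opM op f /\ boundary_compact_map opM f) in
  let c5 := metalindelof op /\
            exists B, is_base op B /\ point_regular_nonisolated op B in
  (c1 <-> c2) /\ (c2 <-> c3) /\ (c3 <-> c4) /\ (c4 <-> c5).
Proof.
  intros c1 c2 c3 c4 c5.
  (* Two cycles link all conditions: [c2 -> c1 -> c5 -> c2] and [c1 -> c5 -> c3 -> c4 -> c1]. *)
  assert (H21 : c2 -> c1).
  { intros [B [H1 [H2 H3]]]. split; now exists B. }
  assert (H15 : c1 -> c5).
  { intros [[B [H1 H2]] H3]. split; auto.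
    now apply (point_countable_base_metalindelof op B). }
  assert (H5dev : c5 -> exists G, nonisolated_development op G /\
    forall n, point_countable (G n)).
  { intros [Hm [B [H1 H2]]].
    eapply metalindelof_development; eauto. apply peel_development; eauto. }
  assert (H52 : c5 -> c2).
  { intros H. destruct (H5dev H) as [G [HG Hpc]].
    exists (fun b => exists n, completed op G n b). split; [|split].
    - now apply development_base.
    - now apply development_base_countable.
    - now apply development_base_regular. }
  assert (H53 : c5 -> c3).
  { intros H. destruct (H5dev H) as [G [HG Hpc]].
    exists (sequence_space op G), (sequence_dist op G), (point_of op G).
    split; [|split; [|split; [|split; [|split]]]].
    - now apply sequence_dist_metric.
    - now apply point_of_continuous.
    - now apply point_of_surjective.
    - now apply point_of_open.
    - now apply point_of_boundary_compact.
    - now apply point_of_s_map. }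
  assert (H34 : c3 -> c4).
  { intros [M [d [f [H1 [H2 [H3 [H4 [H5 H6]]]]]]]].
    split; exists M, d, f; auto. }
  assert (H41 : c4 -> c1).
  { intros [[M [d [f [H1 [H2 [H3 [H4 H5]]]]]]] [M' [d' [f' [H1' [H2' [H3' [H4' H5']]]]]]]].
    split.
    - now apply (open_s_image_point_countable_base op d H1 f).
    - destruct (open_boundary_compact_image_development op Htop HT1 d' H1' f')
        as [G HG]; auto.
      exists (fun b => exists n, completed op G n b). split.
      + now apply development_base.
      + now apply development_base_regular. }
  tauto.
Qed.
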